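(* Let $L$ be a multiplicative lattice. Every lower space $\Sigma_L$ of $L$ is a $T_0$-space.
   Context: A multiplicative lattice is a complete lattice $(L,\leqslant,0,1)$ with a binary operation $\cdot$ that is associative, commutative, satisfies $x\cdot 1=x$, and satisfies $x\cdot\bigvee_{\lambda\in\Lambda}y_\lambda=\bigvee_{\lambda\in\Lambda}(x\cdot y_\lambda)$ for all $x\in L$ and all families $(y_\lambda)_{\lambda\in\Lambda}$ in $L$. $x^n$ is the $n$-fold product. Element $x$ is proper if $x\neq 1$. A proper $p$ is prime if $x\cdot y\leqslant p$ implies $x\leqslant p$ or $y\leqslant p$; a prime $p$ is minimal prime if there is no prime $q\neq p$ with $q\leqslant p$. A proper $m$ is maximal if $m\leqslant n$ and $n\neq 1$ imply $m=n$. An element $c$ is compact if $c\leqslant\bigvee_{\lambda\in\Lambda}x_\lambda$ implies $c\leqslant\bigvee_{i=1}^n x_{\lambda_i}$ for some finite subfamily. $x$ is idempotent if $x\cdot x=x$, nilpotent if $x^n=0$ for some $n\geq 1$. The radical of $x$ is $\sqrt{x}=\bigvee\{y\in L\mid y \text{ compact},\ y^n\leqslant x \text{ for some } n\geq 1\}=\bigwedge\{p \text{ prime}\mid x\leqslant p\}$ (the two expressions are taken to agree); $r$ is a radical element if $r=\sqrt r$. $q$ is primary if $x\cdot y\leqslant q$ implies $x\leqslant q$ or $y\leqslant\sqrt q$. $s$ is strongly irreducible if $x\wedge y\leqslant s$ implies $x\leqslant s$ or $y\leqslant s$; irreducible if $x\wedge y=s$ implies $x=s$ or $y=s$; completely irreducible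 if $s=\bigwedge_{\lambda\in\Lambda}x_\lambda$ implies $s=x_\lambda$ for some $\lambda$. A class $\Sigma_L$ of elements of $L$ is any one of the sets of: proper, prime, minimal prime, maximal, compact, idempotent, nilpotent, radical, primary, strongly irreducible, irreducible, completely irreducible elements of $L$. For $x\in L$ put $v(x)=\{l\in\Sigma_L\mid x\leqslant l\}$. The lower space $\Sigma_L$ is the set $\Sigma_L$ with the lower topology, i.e. the topology for which $\{v(x)\mid x\in L\}$ is a subbasis of closed sets. *)

(* Defs.v *)
From HB Require Import structures.
From mathcomp Require Import all_boot all_order.
From mathcomp Require Import boolp classical_sets cardinality.
From mathcomp Require Import topology.

Set Implicit Arguments.
Unset Strict Implicit.
Unset Printing Implicit Defensive.

Import Order.Theory.

Local Open Scope classical_set_scope.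
Local Open Scope order_scope.

(* Families of elements are represented by the sets of their values. *)
HB.mixin Record isCompleteLattice (d : Order.disp_t) L & Order.TBLattice d L := {
  bigjoin : set L -> L;
  bigjoinP : forall A : set L, supremums A (bigjoin A)
}.

#[short(type="completeLatticeType")]
HB.structure Definition CompleteLattice (d : Order.disp_t) :=
  {L of Order.TBLattice d L & isCompleteLattice d L}.

Definition bigmeet (d : Order.disp_t) (L : completeLatticeType d) (A : set L)
  : L := bigjoin (lbound A).

(* The monoid structure provides associativity, the unit laws and powers. *)
HB.mixin Record isMultLattice (d : Order.disp_t) L
    & CompleteLattice d L & Monoid L := {
  mulLC : forall x y : L, (x * y = y * x)%g;
  oneL : 1%g = \top :> L;
  mulL_bigjoin : forall (x : L) (A : set L),
    (x * bigjoin A)%g = bigjoin [set (x * y)%g | y in A]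
}.

#[short(type="multLatticeType")]
HB.structure Definition MultLattice (d : Order.disp_t) :=
  {L of CompleteLattice d L & Monoid L & isMultLattice d L}.

Section Elements.
Context (d : Order.disp_t) (L : multLatticeType d).
Implicit Types x y : L.

Definition proper_elt x := x != \top.

Definition prime_elt (p : L) :=
  proper_elt p /\
  forall x y, (x * y)%g <= p -> x <= p \/ y <= p.

Definition minimal_prime_elt (p : L) :=
  prime_elt p /\ ~ exists q : L, [/\ prime_elt q, q != p & q <= p].

Definition maximal_elt (m : L) :=
  proper_elt m /\ forall n : L, m <= n -> n != \top -> m = n.

(* The finite subfamily may be empty, so that \bot is compact. *)
Definition compact_elt (c : L) :=
  forall A : set L, c <= bigjoin A ->
    exists F : set L, [/\ finite_set F, F `<=` A & c <= bigjoin F].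

Definition idempotent_elt x := (x * x)%g = x.

Definition nilpotent_elt x := exists2 n, (0 < n)%N & (x ^+ n)%g = \bot.

(* In general this is only below the meet of the primes above x; nothing here
   depends on the two being equal. *)
Definition radical x : L :=
  bigjoin [set y | compact_elt y /\ exists2 n, (0 < n)%N & (y ^+ n)%g <= x].

Definition radical_elt (r : L) := r = radical r.

Definition primary_elt (q : L) :=
  forall x y, (x * y)%g <= q -> x <= q \/ y <= radical q.

Definition strongly_irreducible_elt (s : L) :=
  forall x y, x `&` y <= s -> x <= s \/ y <= s.

Definition irreducible_elt (s : L) :=
  forall x y, x `&` y = s -> x = s \/ y = s.

(* The family may be empty, which excludes s = \top. *)
Definition completely_irreducible_elt (s : L) :=
  forall A : set L, s = bigmeet A -> A s.

End Elements.

Variant element_class :=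
  | Proper | Prime | MinimalPrime | Maximal | Compact | Idempotent | Nilpotent
  | Radical | Primary | StronglyIrreducible | Irreducible
  | CompletelyIrreducible.

Definition elements_of (d : Order.disp_t) (L : multLatticeType d)
    (c : element_class) : set L :=
  match c with
  | Proper => [set x | proper_elt x]
  | Prime => [set x | prime_elt x]
  | MinimalPrime => [set x | minimal_prime_elt x]
  | Maximal => [set x | maximal_elt x]
  | Compact => [set x | compact_elt x]
  | Idempotent => [set x | idempotent_elt x]
  | Nilpotent => [set x | nilpotent_elt x]
  | Radical => [set x | radical_elt x]
  | Primary => [set x | primary_elt x]
  | StronglyIrreducible => [set x | strongly_irreducible_elt x]
  | Irreducible => [set x | irreducible_elt x]
  | CompletelyIrreducible => [set x | completely_irreducible_elt x]
  end.
Arguments elements_of {d} L c.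

(* An alias of the subtype of elements of Sigma, so that the lower topology
   does not compete with other topologies on that subtype. *)
Definition lower_space (d : Order.disp_t) (L : multLatticeType d)
  (Sigma : set L) : Type := set_type Sigma.

Section LowerTopology.
Context (d : Order.disp_t) (L : multLatticeType d) (Sigma : set L).

HB.instance Definition _ := Choice.copy (lower_space Sigma) (set_type Sigma).

Definition upper_elts (x : L) : set (lower_space Sigma) :=
  [set l | x <= val l].

(* The complements of a subbasis of closed sets form a subbasis of open sets. *)
HB.instance Definition _ := @isSubBaseTopological.Build (lower_space Sigma)
  (set (lower_space Sigma)) [set ~` upper_elts x | x in [set: L]] id.

End LowerTopology.
Arguments upper_elts {d L} Sigma x.

(* Main.v *)
Require Import Defs.
From HB Require Import structures.
From mathcomp Require Import all_boot all_order.
From mathcomp Require Import boolp classical_sets cardinality.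
From mathcomp Require Import topology.

Import Order.Theory.

Local Open Scope order_scope.
Local Open Scope classical_set_scope.

(** The order itself separates points: if [a] is not below [b], the complement of [upper_elts S a]
    is open, contains [b] and misses [a]. By antisymmetry, two distinct points fail to be comparable
    in at least one direction. This works for any set [S] of elements, hence for each class. *)

Lemma open_setC_upper_elts (d : Order.disp_t) (L : multLatticeType d)
    (S : set L) (x : L) :
  open (~` upper_elts S x).
Proof.
(* Open sets are unions of finite intersections of subbasic sets; here both the union and the
   intersection have one member. *)
exists [set ~` upper_elts S x]; last by rewrite bigcup_set1.
by move=> _ ->; apply: (finI_from1 id); exists x.
Qed.

Lemma kolmogorov_lower_space (d : Order.disp_t) (L : multLatticeType d)
    (S : set L) :
  kolmogorov_space (lower_space S).
Proof.
have sep (a b : lower_space S) : ~~ (val a <= val b) ->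
    ~` upper_elts S (val a) \in nbhs b /\ a \in ~` (~` upper_elts S (val a)).
  move=> nab; split; last by rewrite setCK; apply/mem_set/le_refl.
  apply/mem_set/open_nbhs_nbhs; split; first exact: open_setC_upper_elts.
  by apply/negP.
move=> x y neq_xy; have [xy|nxy] := boolP (val x <= val y).
  (* As [x] lies below [y], [y] cannot lie below [x], so this open set contains [x] and misses
     [y]. *)
  exists (~` upper_elts S (val y)); left; apply: sep; apply: contra neq_xy => yx.
  by apply/eqP/val_inj/le_anti; rewrite xy yx.
by exists (~` upper_elts S (val x)); right; apply: sep.
Qed.

Theorem proposition2p10 (d : Order.disp_t) (L : multLatticeType d)
    (Sigma : element_class) :
  kolmogorov_space (lower_space (elements_of L Sigma)).
Proof. exact: kolmogorov_lower_space. Qed.
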